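(* Let $p$ be a prime, let $G$ be a finitely generated pro-$p$ group of positive rank gradient, and let $H \le G$ be a finitely generated closed subgroup. Then the following are equivalent: (1) $H$ contains an infinite closed subgroup of $G$ that is subnormal in $G$ via finitely generated successive quotients; (2) $H$ contains an infinite closed normal subgroup of $G$; (3) $H$ is open in $G$. In particular, every closed subgroup $K \le G$ that is subnormal in $G$ via finitely generated successive quotients satisfies: $K$ is finitely generated if and only if $K$ is either finite or open in $G$.
   Context: Subgroups of pro-$p$ groups are understood to be closed and generation is topological. For a pro-$p$ group $H$, $d(H)$ denotes the minimal number of (topological) generators of $H$. The rank gradient of a finitely generated pro-$p$ group $G$ is $\mathrm{RG}(G) = \inf_{H} \frac{d(H)-1}{|G:H|}$, where $H$ runs over all open subgroups of $G$; $G$ has positive rank gradient if $\mathrm{RG}(G)>0$. A closed subgroup $K \le G$ is subnormal via finitely generated successive quotients if there is a finite chain $G = K_0 \trianglerighteq K_1 \trianglerighteq \ldots \trianglerighteq K_s = K$ of closed subgroups, with $K_i$ normal in $K_{i-1}$ for each $i\in\{1,\ldots,s\}$, such that each factor $K_{i-1}/K_i$, $i\in\{1,\ldots,s\}$, is a finitely generated pro-$p$ group. *)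

(* Defs.v *)
From HB Require Import structures.
From mathcomp Require Import all_boot all_order all_algebra.
From mathcomp Require Import finmap.
From mathcomp Require Import all_classical all_reals all_analysis.

Set Implicit Arguments.
Unset Strict Implicit.
Unset Printing Implicit Defensive.

Import Order.TTheory GRing.Theory Num.Theory.

Local Open Scope classical_set_scope.
Local Open Scope group_scope.

HB.mixin Record Group_isTopologicalGroup G & Group G & Topological G := {
  mulg_continuous : continuous (fun xy : G * G => xy.1 * xy.2);
  invg_continuous : continuous (fun x : G => x^-1)
}.

#[short(type="topologicalGroupType")]
HB.structure Definition TopologicalGroup :=
  {G of Group G & Topological G & Group_isTopologicalGroup G}.

Section Subgroups.
Context {G : groupType}.
Implicit Types (x y : G) (H K N : set G).

Definition subgroup H :=
  [/\ H 1, forall x y, H x -> H y -> H (x * y) & forall x, H x -> H x^-1].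

Definition normal_in N K :=
  [/\ subgroup N, subgroup K, N `<=` K & forall x y, K x -> N y -> N (y ^ x)].

Definition lcoset_set x N : set G := [set x * y | y in N].

Definition lcosets_set N K : set (set G) := [set lcoset_set x N | x in K].

(* [fset_set] sends an infinite set to the empty one, so [group_index K N] is
   0 when |K : N| is infinite; a positive value is always the genuine index. *)
Definition group_index K N : nat := #|` fset_set (lcosets_set N K)|.

End Subgroups.

(* The topological group K/N; its carrier is the set of cosets xN with x in K.
   The normality proof is an argument because the group structure needs it. *)
Definition quotient_group (G : topologicalGroupType) (N K : set G)
  (nNK : normal_in N K) : Type := {C : set G | C \in lcosets_set N K}.

Section QuotientGroup.
Context {G : topologicalGroupType} (N K : set G) (nNK : normal_in N K).
Implicit Types (x y : G).

Local Notation Q := (quotient_group nNK).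

HB.instance Definition _ := Choice.on Q.

Let N1 : N 1. Proof. by case: nNK => -[]. Qed.
Let NM x y : N x -> N y -> N (x * y). Proof. by case: nNK => -[_ + _] _ _ _; apply. Qed.
Let NV x : N x -> N x^-1. Proof. by case: nNK => -[_ _ +] _ _ _; apply. Qed.
Let K1 : K 1. Proof. by case: nNK => _ []. Qed.
Let KM x y : K x -> K y -> K (x * y). Proof. by case: nNK => _ [_ + _] _ _; apply. Qed.
Let KV x : K x -> K x^-1. Proof. by case: nNK => _ [_ _ +] _ _; apply. Qed.
Let NK x : N x -> K x. Proof. by case: nNK => _ _ + _; apply. Qed.
Let NJ x y : K x -> N y -> N (y ^ x). Proof. by case: nNK => _ _ _; apply. Qed.

Lemma lcoset_setP x z : lcoset_set x N z <-> N (x^-1 * z).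
Proof.
split=> [[y Ny <-]|Nz]; first by rewrite mulKg.
by exists (x^-1 * z) => //; rewrite mulVKg.
Qed.

Lemma lcoset_set_eq x y : N (x^-1 * y) -> lcoset_set x N = lcoset_set y N.
Proof.
move=> Nxy; apply/seteqP; split=> z /lcoset_setP Nz; apply/lcoset_setP.
  have -> : y^-1 * z = (x^-1 * y)^-1 * (x^-1 * z).
    by rewrite invgM invgK -mulgA mulVKg.
  by apply: NM => //; exact: NV.
have -> : x^-1 * z = (x^-1 * y) * (y^-1 * z) by rewrite -mulgA mulVKg.
exact: NM.
Qed.

Definition quotient_proj x (Kx : K x) : Q :=
  exist _ (lcoset_set x N) (mem_set (imageP (lcoset_set^~ N) Kx)).

Lemma quotient_projE (C : Q) : exists x (Kx : K x), C = quotient_proj Kx.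
Proof.
case: C => C memC; have /set_mem[x Kx eC] := memC.
by exists x, Kx; exact: val_inj.
Qed.

Lemma quotient_proj_eq x y (Kx : K x) (Ky : K y) :
  N (x^-1 * y) -> quotient_proj Kx = quotient_proj Ky.
Proof. by move=> Nxy; apply: val_inj; exact: lcoset_set_eq. Qed.

Let mul_lcoset x y : K x -> K y ->
  [set a * b | a in lcoset_set x N & b in lcoset_set y N] =
  lcoset_set (x * y) N.
Proof.
move=> Kx Ky; apply/seteqP; split=> z.
  move=> [_ [a Na <-]] [_ [b Nb <-] <-]; apply/lcoset_setP.
  have -> : (x * y)^-1 * (x * a * (y * b)) = a ^ y * b.
    by rewrite invgM /conjg !mulgA mulgVK.
  by apply: NM => //; exact: NJ.
move=> [a Na <-]; exists x; first by apply/lcoset_setP; rewrite mulVg.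
by exists (y * a); [exists a|rewrite mulgA].
Qed.

Let inv_lcoset x : K x ->
  [set a^-1 | a in lcoset_set x N] = lcoset_set x^-1 N.
Proof.
move=> Kx; apply/seteqP; split=> z.
  move=> [_ [a Na <-] <-]; apply/lcoset_setP; rewrite invgK invgM.
  have -> : x * (a^-1 * x^-1) = a^-1 ^ x^-1 by rewrite /conjg invgK.
  by apply: NJ; [exact: KV|exact: NV].
move=> [a Na <-]; exists (a^-1 * x); last by rewrite invgM invgK.
by apply/lcoset_setP; rewrite -/(conjg _ _); apply: NJ => //; exact: NV.
Qed.

Let mul_proof (C D : Q) :
  [set a * b | a in val C & b in val D] \in lcosets_set N K.
Proof.
have [x [Kx ->]] := quotient_projE C; have [y [Ky ->]] := quotient_projE D.
by rewrite mul_lcoset//; apply/mem_set; exists (x * y) => //; exact: KM.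
Qed.

Let inv_proof (C : Q) :
  [set a^-1 | a in val C] \in lcosets_set N K.
Proof.
have [x [Kx ->]] := quotient_projE C.
by rewrite inv_lcoset//; apply/mem_set; exists x^-1 => //; exact: KV.
Qed.

Definition quotient_one : Q := quotient_proj K1.
Definition quotient_mul (C D : Q) : Q :=
  exist (fun A => A \in lcosets_set N K) _ (mul_proof C D).
Definition quotient_inv (C : Q) : Q :=
  exist (fun A => A \in lcosets_set N K) _ (inv_proof C).

Lemma quotient_mulE x y (Kx : K x) (Ky : K y) (Kxy : K (x * y)) :
  quotient_mul (quotient_proj Kx) (quotient_proj Ky) = quotient_proj Kxy.
Proof. by apply: val_inj; exact: mul_lcoset. Qed.

Lemma quotient_invE x (Kx : K x) (KxV : K x^-1) :
  quotient_inv (quotient_proj Kx) = quotient_proj KxV.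
Proof. by apply: val_inj; exact: inv_lcoset. Qed.

Let mulE x y (Kx : K x) (Ky : K y) := quotient_mulE Kx Ky (KM Kx Ky).

Let invE x (Kx : K x) := quotient_invE Kx (KV Kx).

Let quotient_mulA : associative quotient_mul.
Proof.
move=> A B C.
have [x [Kx ->]] := quotient_projE A; have [y [Ky ->]] := quotient_projE B.
have [z [Kz ->]] := quotient_projE C.
by rewrite !mulE; apply: quotient_proj_eq; rewrite (mulgA x y z) mulVg.
Qed.

Let quotient_mul1 : left_id quotient_one quotient_mul.
Proof.
move=> A; have [x [Kx ->]] := quotient_projE A.
by rewrite mulE; apply: quotient_proj_eq; rewrite mul1g mulVg.
Qed.

Let quotient_1mul : right_id quotient_one quotient_mul.
Proof.
move=> A; have [x [Kx ->]] := quotient_projE A.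
by rewrite mulE; apply: quotient_proj_eq; rewrite mulg1 mulVg.
Qed.

Let quotient_mulV : left_inverse quotient_one quotient_inv quotient_mul.
Proof.
move=> A; have [x [Kx ->]] := quotient_projE A.
by rewrite invE mulE; apply: quotient_proj_eq; rewrite mulVg mulg1 invg1.
Qed.

Let quotient_Vmul : right_inverse quotient_one quotient_inv quotient_mul.
Proof.
move=> A; have [x [Kx ->]] := quotient_projE A.
by rewrite invE mulE; apply: quotient_proj_eq; rewrite mulgV mulg1 invg1.
Qed.

HB.instance Definition _ := isGroup.Build Q
  quotient_mulA quotient_mul1 quotient_1mul quotient_mulV quotient_Vmul.

(* Quotient topology: U is open iff its preimage in K, i.e. the union of the
   cosets in U, is relatively open in K *)
Definition quotient_group_open (U : set Q) : Prop :=
  open ((\bigcup_(C in U) val C) : set (subspace K)).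

Let quotient_bigcupE (U : set Q) x (Kx : K x) :
  (\bigcup_(C in U) val C) x <-> U (quotient_proj Kx).
Proof.
split=> [[C UC]|Ux]; last first.
  by exists (quotient_proj Kx) => //=; apply/lcoset_setP; rewrite mulVg.
have [y [Ky eC]] := quotient_projE C; rewrite eC => /lcoset_setP Nyx.
by rewrite -(quotient_proj_eq Ky Kx Nyx) -eC.
Qed.

Let quotient_bigcup_sub (U : set Q) :
  \bigcup_(C in U) val C `<=` K.
Proof.
move=> x [C _]; have [y [Ky ->]] := quotient_projE C => -[a Na <-].
by apply: KM => //; exact: NK.
Qed.

Lemma quotient_group_openP (U : set Q) :
  quotient_group_open U <->
  exists2 W : set G, open W &
    forall x (Kx : K x), W x <-> U (quotient_proj Kx).
Proof.
rewrite /quotient_group_open open_subspaceP; split=> -[W oW WE]; exists W => //.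
  move=> x Kx; rewrite -(quotient_bigcupE U Kx).
  move/seteqP: WE => [WE1 WE2]; split=> [Wx|Ux].
    by have [] := WE1 x (conj Wx Kx).
  by have [] := WE2 x (conj Ux Kx).
apply/seteqP; split=> x [Hx Kx]; split=> //.
  by apply/(quotient_bigcupE U Kx)/WE.
by apply/(WE x Kx)/quotient_bigcupE.
Qed.

Let quotient_group_openT : quotient_group_open setT.
Proof. by apply/quotient_group_openP; exists setT => //; exact: openT. Qed.

Let quotient_group_openI : setI_closed quotient_group_open.
Proof.
move=> U V /quotient_group_openP[A oA AE] /quotient_group_openP[B oB BE].
apply/quotient_group_openP; exists (A `&` B); first exact: openI.
by move=> x Kx; split=> -[/AE ? /BE ?].
Qed.

Let quotient_group_open_bigU (I : Type) (f : I -> set Q) :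
  (forall i, quotient_group_open (f i)) -> quotient_group_open (\bigcup_i f i).
Proof.
move=> of_; apply/quotient_group_openP.
have /choice[W WE] : forall i, exists W : set G, open W /\
    forall x (Kx : K x), W x <-> f i (quotient_proj Kx).
  by move=> i; have /quotient_group_openP[W ? ?] := of_ i; exists W.
exists (\bigcup_i W i); first by apply: bigcup_open => i _; case: (WE i).
move=> x Kx; split=> -[i _ Hi]; exists i => //; case: (WE i) => _ /(_ x Kx) E;
  exact/E.
Qed.

HB.instance Definition _ := isOpenTopological.Build Q
  quotient_group_openT quotient_group_openI quotient_group_open_bigU.

Lemma open_quotient_groupE (U : set Q) : open U <-> quotient_group_open U.
Proof. by []. Qed.

Let openM x (W : set G) : open W -> open [set y | W (y * x)].
Proof.
move=> oW; apply: (@open_comp _ _ (fun y : G => y * x)) => // y _.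
apply: (@continuous_comp _ _ _ (fun y => (y, x)) (fun xy => xy.1 * xy.2)).
  by apply: cvg_pair => //=; exact: cvg_cst.
exact: mulg_continuous.
Qed.

Lemma quotient_proj_open (W : set G) : open W ->
  open [set C : Q | exists x (Kx : K x), W x /\ C = quotient_proj Kx].
Proof.
move=> oW; apply/open_quotient_groupE/quotient_group_openP.
exists (\bigcup_(n in N) [set y | W (y * n)]).
  by apply: bigcup_open => n _; exact: openM.
move=> x Kx; split=> [[n Nn /= Wxn]|[y [Ky [Wy /(congr1 val)/= e]]]].
  exists (x * n), (KM Kx (NK Nn)); split=> //.
  by apply: quotient_proj_eq; rewrite mulKg.
exists (x^-1 * y); last by rewrite /= mulVKg.
by apply/lcoset_setP; rewrite e; apply/lcoset_setP; rewrite mulVg.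
Qed.

Lemma nbhs_quotient_proj x (Kx : K x) (A : set G) : nbhs x A ->
  nbhs (quotient_proj Kx)
    [set C | exists y (Ky : K y), A y /\ C = quotient_proj Ky].
Proof.
rewrite nbhsE => -[W [oW Wx] WA]; rewrite nbhsE.
exists [set C | exists y (Ky : K y), W y /\ C = quotient_proj Ky].
  by split; [exact: quotient_proj_open|exists x, Kx].
by move=> _ [y [Ky [/WA Ay ->]]]; exists y, Ky.
Qed.

Let quotient_mul_continuous :
  continuous (fun xy : Q * Q => xy.1 * xy.2).
Proof.
move=> [C D]; have [x [Kx ->]] := quotient_projE C; have [y [Ky ->]] := quotient_projE D.
move=> U; rewrite nbhsE => -[V [/open_quotient_groupE/quotient_group_openP[W oW WE] Vxy] VU].
have Wxy : W (x * y) by apply/(WE _ (KM Kx Ky)); rewrite -mulE.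
have := @mulg_continuous G (x, y) W (open_nbhs_nbhs (conj oW Wxy)).
move=> [[A B] [/= nA nB] AB].
exists ([set C | exists y (Ky : K y), A y /\ C = quotient_proj Ky],
        [set C | exists y (Ky : K y), B y /\ C = quotient_proj Ky]).
  by split; exact: nbhs_quotient_proj.
move=> [_ _] [/= [a [Ka [Aa ->]]] [b [Kb [Bb ->]]]].
apply: VU; rewrite [_ * _]mulE; apply/WE.
exact: (AB (a, b)).
Qed.

Let quotient_inv_continuous : continuous (fun x : Q => x^-1).
Proof.
move=> C; have [x [Kx ->]] := quotient_projE C.
move=> U; rewrite nbhsE => -[V [/open_quotient_groupE/quotient_group_openP[W oW WE] Vx] VU].
have Wx : W x^-1 by apply/(WE _ (KV Kx)); rewrite -invE.
have nA := @invg_continuous G x W (open_nbhs_nbhs (conj oW Wx)).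
apply: filterS (nbhs_quotient_proj Kx nA) => _ [a [Ka [Aa ->]]].
by apply: VU; rewrite [_^-1]invE; apply/WE.
Qed.

HB.instance Definition _ := Group_isTopologicalGroup.Build Q
  quotient_mul_continuous quotient_inv_continuous.

End QuotientGroup.

Section ProPGroups.
Implicit Types G : topologicalGroupType.

(* Profinite: compact, Hausdorff, the open subgroups form a base of
   neighbourhoods of 1; pro-p: moreover every open normal subgroup has index
   a power of p. *)
Definition pro_p (p : nat) G :=
  [/\ compact [set: G], hausdorff_space G,
      forall U, nbhs (1 : G) U ->
        exists V : set G, [/\ subgroup V, open V & V `<=` U] &
      forall V : set G, normal_in V [set: G] -> open V ->
        exists k, group_index [set: G] V = (p ^ k)%N].

Definition closed_subgroup G (H : set G) := subgroup H /\ closed H.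

Definition topologically_generated G (S : set G) : set G :=
  closure (smallest subgroup S).

Definition generated_by_tuple G (H : set G) (n : nat) :=
  exists s : n.-tuple G, topologically_generated [set` s] = H.

Definition finitely_generated G (H : set G) :=
  exists n, generated_by_tuple H n.

Local Open Scope ereal_scope.

(* d(H), which is +oo when H is not finitely generated *)
Definition min_generators (R : realType) G (H : set G) : \bar R :=
  ereal_inf [set n%:R%:E | n in generated_by_tuple H].

Definition rank_gradient (R : realType) G : \bar R :=
  ereal_inf [set (min_generators R H - 1) * ((group_index [set: G] H)%:R^-1)%:E
            | H in [set H : set G | subgroup H /\ open H]].

Definition subnormal_fg (p : nat) G (K : set G) :=
  exists (s : nat) (C : nat -> set G),
    [/\ C 0%N = [set: G], C s = K,
        forall i, (i <= s)%N -> closed_subgroup (C i) &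
        forall i, (i < s)%N ->
          exists nC : normal_in (C i.+1) (C i),
            pro_p p (quotient_group nC) /\
            finitely_generated [set: quotient_group nC]].

End ProPGroups.

(* Main.v *)
(* Let G = K_0 > K_1 > ... > K_s = K be the subnormal chain, K <= H, and let V be
   an open normal subgroup of G. Schreier generators of (V `&` K_(i-1)) K_i,
   corrected by elements of K_i, show that V `&` K_(i-1) is generated by
   V `&` K_i together with d(K_(i-1)/K_i) |K_(i-1) : (V `&` K_(i-1)) K_i|
   elements, and this index is at most |G : V| / |K : V `&` K|. Since
   V `&` K <= V `&` H, which needs at most d(H) |HV : V| generators,
     d(V) / |G : V| <= (sum of the d(K_(i-1)/K_i)) / |K : V `&` K|
                       + d(H) / |G : HV|.
   If K is infinite and H is not open, both terms tend to 0 as V shrinks,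
   contradicting the positivity of the rank gradient. *)
Require Import Defs.
From HB Require Import structures.
From mathcomp Require Import all_boot all_order all_algebra.
From mathcomp Require Import finmap.
From mathcomp Require Import all_classical all_reals all_analysis.

Set Implicit Arguments.
Unset Strict Implicit.
Unset Printing Implicit Defensive.

Import Order.TTheory GRing.Theory Num.Theory.

Local Open Scope classical_set_scope.
Local Open Scope group_scope.

(* Left-associated normal form: decides identities that hold in free groups. *)
Local Definition group_simp := (@conjgE, @invgM, @invgK, @invg1, @mulgA, @mulg1,
  @mul1g, @mulgK, @mulgVK, @mulVg, @mulgV).

(** * Abstract groups: cosets, indices and Schreier generators *)

Section AbstractGroups.
Context {G : groupType}.
Implicit Types (x y : G) (A B H K N V X Y S : set G).

Definition mulset A B : set G := [set a * b | a in A & b in B].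

Lemma subgroup1 : subgroup [set (1 : G)].
Proof. by split=> [//|x y -> ->|x ->] /=; rewrite ?mulg1 ?invg1. Qed.

Lemma subgroupT : subgroup [set: G]. Proof. by []. Qed.

Lemma subgroupI A B : subgroup A -> subgroup B -> subgroup (A `&` B).
Proof.
move=> [A1 AM AV] [B1 BM BV]; split=> // [x y [? ?] [? ?]|x [? ?]].
  by split; [exact: AM|exact: BM].
by split; [exact: AV|exact: BV].
Qed.

Lemma subgroup_bigcap I (P : set I) (F : I -> set G) :
  (forall i, P i -> subgroup (F i)) -> subgroup (\bigcap_(i in P) F i).
Proof.
move=> sF; split=> [i Pi|x y Fx Fy i Pi|x Fx i Pi]; have [F1 FM FV] := sF _ Pi => //.
  by apply: FM; [exact: Fx|exact: Fy].
by apply: FV; exact: Fx.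
Qed.

Lemma subgroup_smallest S : subgroup (smallest subgroup S).
Proof. by apply: subgroup_bigcap => i []. Qed.

Lemma mulset_subr A B : A 1 -> B `<=` mulset A B.
Proof. by move=> A1 b Bb; exists 1 => //; exists b => //; rewrite mul1g. Qed.

Lemma mulset_subl A B : B 1 -> A `<=` mulset A B.
Proof. by move=> B1 a Aa; exists a => //; exists 1 => //; rewrite mulg1. Qed.

Lemma mulset_sub A B K : subgroup K -> A `<=` K -> B `<=` K -> mulset A B `<=` K.
Proof. by move=> [_ KM _] AK BK _ [a /AK Ka [b /BK Kb <-]]; exact: KM. Qed.

Lemma subgroup_mulset D N A : subgroup D -> normal_in N A -> D `<=` A ->
  subgroup (mulset D N).
Proof.
move=> [D1 DM DV] [[N1 NM NV] _ _ NJ] DA; split.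
- by exists 1 => //; exists 1 => //; rewrite mulg1.
- move=> _ _ [d Dd [n Nn <-]] [d' Dd' [n' Nn' <-]].
  exists (d * d'); first exact: DM.
  exists (n ^ d' * n'); last by rewrite !group_simp.
  by apply: NM => //; apply: NJ => //; exact: DA.
- move=> _ [d Dd [n Nn <-]]; exists d^-1; first exact: DV.
  exists (n^-1 ^ d^-1); last by rewrite !group_simp.
  by apply: NJ; [apply: DA; exact: DV|exact: NV].
Qed.

Lemma mem_lcosetP N x z : lcoset_set x N z <-> N (x^-1 * z).
Proof.
split=> [[y Ny <-]|Nz]; first by rewrite mulKg.
by exists (x^-1 * z) => //; rewrite mulVKg.
Qed.

Lemma lcoset_eqP N x y : subgroup N ->
  lcoset_set x N = lcoset_set y N <-> N (x^-1 * y).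
Proof.
move=> [N1 NM NV]; split=> [e|Nxy].
  by apply/mem_lcosetP; rewrite e; apply/mem_lcosetP; rewrite mulVg.
apply/seteqP; split=> z /mem_lcosetP Nz; apply/mem_lcosetP.
  have -> : y^-1 * z = (x^-1 * y)^-1 * (x^-1 * z) by rewrite !group_simp.
  by apply: NM => //; exact: NV.
have -> : x^-1 * z = (x^-1 * y) * (y^-1 * z) by rewrite !group_simp.
exact: NM.
Qed.

Lemma lcoset_set1P N x : subgroup N -> lcoset_set x N = N <-> N x.
Proof.
move=> sN; have [N1 NM NV] := sN.
have e : lcoset_set 1 N = N.
  by apply/seteqP; split=> z => [[y Ny <-]|Nz];
    [rewrite mul1g|exists z; rewrite ?mul1g].
rewrite -{2}e; split=> [/(lcoset_eqP _ _ sN)/NV|Nx].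
  by rewrite !group_simp.
by apply/(lcoset_eqP _ _ sN); rewrite mulg1; exact: NV.
Qed.

Lemma lcoset_setM N x y : lcoset_set (x * y) N = [set x * z | z in lcoset_set y N].
Proof.
apply/seteqP; split=> z.
  by move=> [n Nn <-]; exists (y * n); [exists n|rewrite mulgA].
by move=> [_ [n Nn <-] <-]; exists n => //; rewrite mulgA.
Qed.

Lemma sub_lcosets N K K' : K `<=` K' -> lcosets_set N K `<=` lcosets_set N K'.
Proof. by move=> KK' _ [x /KK' Kx <-]; exists x. Qed.

Lemma lcosets_repr N K : exists r : set G -> G,
  forall C, lcosets_set N K C -> K (r C) /\ lcoset_set (r C) N = C.
Proof.
have /choice[r rP] : forall C : set G, exists x,
    lcosets_set N K C -> K x /\ lcoset_set x N = C.
  move=> C; have [[x Kx eC]|nC] := pselect (lcosets_set N K C); first by exists x.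
  by exists 1 => /nC.
by exists r.
Qed.

(** For [x] in [K] the coset xV determines xN: elements of [K] in one coset of [V] differ by an
    element of [V] and [K], hence of [N]. *)
Lemma lcosets_sub_finite N V K : subgroup N -> subgroup V -> subgroup K ->
  V `&` K `<=` N ->
  finite_set (lcosets_set V K) -> finite_set (lcosets_set N K).
Proof.
move=> sN sV [_ KM KV] VN finV; have [r rP] := lcosets_repr V K.
apply: (sub_finite_set _ (finite_image (fun C => lcoset_set (r C) N) finV)).
move=> _ [x Kx <-]; exists (lcoset_set x V); first by exists x.
have [Kr /(lcoset_eqP _ _ sV) Vx] := rP (lcoset_set x V) (imageP _ Kx).
by apply/(lcoset_eqP _ _ sN)/VN; split=> //; apply: KM => //; exact: KV.
Qed.

(** Here and below [group_index K N] is also taken with [N] not inside [K]; it then counts the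
    cosets of [N] that meet [K], which is |K : K ∩ N| for subgroups. *)
Lemma group_index_ge (I : eqType) (F : seq I) (g : I -> G) K N :
  subgroup N -> finite_set (lcosets_set N K) -> uniq F ->
  (forall i, i \in F -> K (g i)) ->
  (forall i j, i \in F -> j \in F -> N ((g i)^-1 * g j) -> i = j) ->
  (size F <= group_index K N)%N.
Proof.
move=> sN fin uF gK gI; rewrite -(size_map (fun i => lcoset_set (g i) N)).
apply: uniq_leq_size.
  by rewrite map_inj_in_uniq// => i j Fi Fj /(lcoset_eqP _ _ sN); exact: gI.
move=> _ /mapP[i Fi ->]; rewrite in_fset_set// inE.
by exists (g i) => //; exact: gK.
Qed.

Lemma group_index_gt0 K N : K !=set0 -> finite_set (lcosets_set N K) ->
  (0 < group_index K N)%N.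
Proof.
move=> [x Kx] fin; rewrite cardfs_gt0; apply/fset0Pn; exists (lcoset_set x N).
by rewrite in_fset_set// inE; exists x.
Qed.

Lemma group_indexS K K' N : K `<=` K' -> finite_set (lcosets_set N K') ->
  (group_index K N <= group_index K' N)%N.
Proof.
move=> KK' fin; apply: fsubset_leq_card.
have sub := @sub_lcosets N _ _ KK'.
by rewrite -fset_set_sub//; exact: sub_finite_set fin.
Qed.

(** The products [r E * s F] of coset representatives lie in distinct cosets of [V]: the first
    condition recovers [E], and the second then recovers [F]. *)
Lemma mul_group_index_le X Y B C V : subgroup B -> subgroup C -> subgroup V ->
  finite_set (lcosets_set V [set: G]) ->
  (forall x x' y y', X x -> X x' -> Y y -> Y y' ->
     V ((x * y)^-1 * (x' * y')) -> B (x^-1 * x')) ->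
  (forall y y', Y y -> Y y' -> V (y^-1 * y') -> C (y^-1 * y')) ->
  (group_index X B * group_index Y C <= group_index [set: G] V)%N.
Proof.
move=> sB sC sV finV XYB YC.
(* An infinite index has the value 0, which makes the inequality trivial. *)
have [finX|infX] := pselect (finite_set (lcosets_set B X)); last first.
  by rewrite {1}/group_index /fset_set; case: pselect.
have [finY|infY] := pselect (finite_set (lcosets_set C Y)); last first.
  by rewrite mulnC {1}/group_index /fset_set; case: pselect.
have [r rP] := lcosets_repr B X; have [s sP] := lcosets_repr C Y.
rewrite /group_index -(size_allpairs pair).
apply: (group_index_ge (g := fun CD : set G * set G => r CD.1 * s CD.2)) => //.
- by rewrite allpairs_uniq// => -[? ?] [? ?] _ _.
move=> _ _ /allpairsP[[E F] [/= + + ->]] /allpairsP[[E' F'] [/= + + ->]] /=.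
rewrite !in_fset_set// !inE => XE YF XE' YF' VEF.
have [Xr eE] := rP _ XE; have [Xr' eE'] := rP _ XE'.
have [Ys eF] := sP _ YF; have [Ys' eF'] := sP _ YF'.
have eEE : E = E'.
  by rewrite -eE -eE'; apply/(lcoset_eqP _ _ sB); exact: XYB VEF.
rewrite -eEE -eF -eF'; congr pair; apply/(lcoset_eqP _ _ sC)/YC => //.
by move: VEF; rewrite eEE !group_simp.
Qed.

(* Schreier's argument: with a representative r(C) of each coset C = uB, the
   elements t such that r(tC)^-1 t r(C) lies in <Y, N> for all C form a
   subgroup. *)
Lemma schreier (s : seq G) N B : let T := smallest subgroup ([set` s] `|` N) in
  normal_in N T -> subgroup B -> N `<=` B -> finite_set (lcosets_set B T) ->
  exists Y : seq G, [/\ (size Y <= size s * group_index T B)%N,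
    [set` Y] `<=` T `&` B & T `&` B `<=` smallest subgroup ([set` Y] `|` N)].
Proof.
move=> T [sN sT NT NJ] sB NB fin.
have [T1 TM TV] := sT; have [B1 BM BV] := sB; have [N1 NM NV] := sN.
have sT' : [set` s] `<=` T by move=> x xs; apply: sub_gen_smallest; left.
have [r0 r0P] := lcosets_repr B T.
(* The representative of [B] is normalised to 1, so that [u = 1] gives back [t] itself when [t] lies
   in [B]. *)
pose r C := if pselect (C = B) then 1 else r0 C.
have rB : r B = 1 by rewrite /r; case: pselect.
have rP C : lcosets_set B T C -> T (r C) /\ lcoset_set (r C) B = C.
  rewrite /r; case: pselect => [e _|_ /r0P//].
  by rewrite /= e; split=> //; exact/lcoset_set1P.
have rT u : T u -> T (r (lcoset_set u B)).
  by move=> Tu; have [] := rP (lcoset_set u B) (imageP _ Tu).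
have rBE u : T u -> B ((r (lcoset_set u B))^-1 * u).
  move=> Tu; have [_] := rP (lcoset_set u B) (imageP _ Tu).
  by move/(lcoset_eqP _ _ sB).
(* One Schreier generator for each generator [x] and each coset [C]; this is the count in the size
   bound. *)
pose y x C := (r [set x * z | z in C])^-1 * x * r C.
pose Y := [seq y x C | x <- s, C <- enum_fset (fset_set (lcosets_set B T))].
have YP x u : x \in s -> T u ->
    y x (lcoset_set u B) \in Y.
  move=> xs Tu; apply: allpairs_f => //.
  by rewrite in_fset_set// inE; exists u.
exists Y; split.
- by rewrite size_allpairs.
- move=> _ /allpairsP[[x C] /= [xs + ->]].
  rewrite in_fset_set// inE => -[u Tu <-]; rewrite /y -lcoset_setM.
  have Tx := sT' _ xs; have Txu := TM _ _ Tx Tu; split.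
    by apply: (TM); [apply: (TM) => //; apply: TV|]; exact: rT.
  have -> : (r (lcoset_set (x * u) B))^-1 * x * r (lcoset_set u B) =
     (r (lcoset_set (x * u) B))^-1 * (x * u) * ((r (lcoset_set u B))^-1 * u)^-1.
    by rewrite !group_simp.
  by apply: BM; [exact: rBE|apply: BV; exact: rBE].
- set D := smallest _ _; have [D1 DM DV] : subgroup D by exact: subgroup_smallest.
  pose P := [set t | T t /\ forall u, T u ->
    D ((r (lcoset_set (t * u) B))^-1 * t * r (lcoset_set u B))].
  suff TP : T `<=` P.
    move=> t [Tt Bt]; have [_ /(_ 1 T1)] := TP _ Tt.
    have -> : lcoset_set 1 B = B by exact/lcoset_set1P.
    rewrite mulg1; have -> : lcoset_set t B = B by exact/lcoset_set1P.
    by rewrite rB !group_simp.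
  apply: smallest_sub; first split.
  + split=> // u Tu; rewrite mul1g.
    by rewrite !group_simp.
  + move=> a b [Ta Pa] [Tb Pb]; split=> [|u Tu]; first exact: TM.
    have := DM _ _ (Pa _ (TM _ _ Tb Tu)) (Pb _ Tu).
    by rewrite !group_simp.
  + move=> a [Ta Pa]; split=> [|u Tu]; first exact: TV.
    have := DV _ (Pa _ (TM _ _ (TV _ Ta) Tu)).
    by rewrite !group_simp.
  + move=> x [xs|Nx].
      have Tx := sT' _ xs; split=> // u Tu.
      apply: sub_gen_smallest; left; have := YP _ _ xs Tu.
      by rewrite /y lcoset_setM.
    (* An element [x] of [N] fixes every coset, since xu = u x^u with [x ^ u] in [N], inside [B].
       Its Schreier element is then a conjugate of [x], again in [N]. *)
    split=> [|u Tu]; first exact: NT.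
    have -> : lcoset_set (x * u) B = lcoset_set u B.
      apply/(lcoset_eqP _ _ sB).
      have -> : (x * u)^-1 * u = (x ^ u)^-1 by rewrite !group_simp.
      by apply: BV; apply: NB; exact: NJ.
    apply: sub_gen_smallest; right.
    by rewrite -mulgA -conjgE; apply: NJ => //; exact: rT.
Qed.

End AbstractGroups.

(** * Topological groups: closures, compactness and generators of open sections *)

Section TopologicalGroups.
Context {G : topologicalGroupType}.
Implicit Types (x y : G) (A B H K N V U X Y S : set G).

Lemma mulgl_continuous x : continuous (fun y => x * y).
Proof.
move=> y; apply: (@continuous_comp _ _ _ (pair x) (fun xy : G * G => xy.1 * xy.2)).
  by apply: cvg_pair => //=; exact: cvg_cst.
exact: mulg_continuous.
Qed.

Lemma mulgr_continuous x : continuous (fun y => y * x).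
Proof.
move=> y; apply: (@continuous_comp _ _ _ (pair^~ x) (fun xy : G * G => xy.1 * xy.2)).
  by apply: cvg_pair => //=; exact: cvg_cst.
exact: mulg_continuous.
Qed.

Lemma conjg_continuous x : continuous (conjg^~ x).
Proof.
move=> y; rewrite (_ : conjg^~ x = (fun z => x^-1 * z) \o (fun z => z * x)).
  by apply: continuous_comp; [exact: mulgr_continuous|exact: mulgl_continuous].
by apply/funext => z.
Qed.

Lemma lcoset_preimage x V : lcoset_set x V = (fun y => x^-1 * y) @^-1` V.
Proof. by apply/seteqP; split=> z /mem_lcosetP. Qed.

Lemma open_lcoset x V : open V -> open (lcoset_set x V).
Proof.
by rewrite lcoset_preimage => oV; apply: open_comp oV => y _; exact: mulgl_continuous.
Qed.

Lemma closed_lcoset x V : closed V -> closed (lcoset_set x V).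
Proof.
by rewrite lcoset_preimage => cV; apply: closed_comp cV => y _; exact: mulgl_continuous.
Qed.

Lemma nbhs_lcoset x V : subgroup V -> open V -> nbhs x (lcoset_set x V).
Proof.
move=> [V1 _ _] oV; apply: open_nbhs_nbhs; split; first exact: open_lcoset.
by apply/mem_lcosetP; rewrite mulVg.
Qed.

Lemma closure_subgroup H : subgroup H -> subgroup (closure H).
Proof.
move=> [H1 HM HV]; split; first exact: subset_closure.
  move=> x y cx cy U /(@mulg_continuous G (x, y))[[A B] [/= nA nB] AB].
  have [a [Ha Aa]] := cx _ nA; have [b [Hb Bb]] := cy _ nB.
  by exists (a * b); split; [exact: HM|exact: (AB (a, b))].
move=> x cx U /(@invg_continuous G x) /cx[a [Ha Ua]].
by exists a^-1; split=> //; exact: HV.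
Qed.

Lemma tgen_subgroup S : closed_subgroup (topologically_generated S).
Proof.
split; last exact: closed_closure.
exact/closure_subgroup/subgroup_smallest.
Qed.

Lemma sub_tgen S : S `<=` topologically_generated S.
Proof. by move=> x Sx; apply: subset_closure; exact: sub_gen_smallest. Qed.

Lemma tgen_sub S H : closed_subgroup H -> S `<=` H ->
  topologically_generated S `<=` H.
Proof.
move=> [sH /closure_id cH] SH; rewrite {}cH; apply: closureS.
exact: smallest_sub.
Qed.

Lemma open_lcosets_bigcup (P : set (set G)) V : open V ->
  P `<=` lcosets_set V [set: G] -> open (\bigcup_(C in P) C).
Proof. by move=> oV PV; apply: bigcup_open => _ /PV[x _ <-]; exact: open_lcoset. Qed.

(** This form of the complement serves twice: open cosets make an open subgroup closed, and finitely
    many closed cosets make a closed subgroup of finite index open. *)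
Lemma setC_subgroup H : subgroup H ->
  ~` H = \bigcup_(C in lcosets_set H [set: G] `\ H) C.
Proof.
move=> sH; have [H1 _ _] := sH; apply/seteqP; split=> x.
  move=> nHx; exists (lcoset_set x H); last by apply/mem_lcosetP; rewrite mulVg.
  by split; [exists x|move=> /= /(lcoset_set1P _ sH)].
move=> [_ [[y _ <-] nyH] /mem_lcosetP Hyx Hx]; apply: nyH.
have [_ HM HV] := sH; apply/(lcoset_set1P _ sH).
by have := HM _ _ Hx (HV _ Hyx); rewrite !group_simp.
Qed.

Lemma open_subgroup_closed H : subgroup H -> open H -> closed H.
Proof.
move=> sH oH; rewrite -openC setC_subgroup//.
by apply: open_lcosets_bigcup oH _ => C [].
Qed.

Lemma closed_finite_index_open H : subgroup H -> closed H ->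
  finite_set (lcosets_set H [set: G]) -> open H.
Proof.
move=> sH cH fin; rewrite -closedC setC_subgroup//.
apply: closed_bigcup; first exact: finite_setD.
by move=> _ [[x _ <-] _]; exact: closed_lcoset.
Qed.

Lemma compact_finite_index V : compact [set: G] -> subgroup V -> open V ->
  finite_set (lcosets_set V [set: G]).
Proof.
move=> cG sV oV; have [V1 _ _] := sV.
pose T : ptopologicalType := HB.pack (G : Type) (isPointed.Build G 1) G.
have : @cover_compact T setT by rewrite -compact_cover.
move=> /(_ G setT (fun x => lcoset_set x V))[].
- by move=> x _; exact: open_lcoset.
- by move=> x _; exists x => //; apply/mem_lcosetP; rewrite mulVg.
move=> F _ FG; apply: (sub_finite_set _ (finite_image (lcoset_set^~ V) (finite_fset F))).
move=> _ [x _ <-]; have [y /= Fy /mem_lcosetP Vyx] := FG x I.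
by exists y => //; exact/(lcoset_eqP _ _ sV).
Qed.

Lemma closed_mulset A B : compact [set: G] -> hausdorff_space G ->
  closed A -> closed B -> closed (mulset A B).
Proof.
move=> cG hG cA cB; apply: compact_closed => //.
have -> : mulset A B = [set xy.1 * xy.2 | xy in A `*` B].
  apply/seteqP; split=> x; first by move=> [a Aa [b Bb <-]]; exists (a, b).
  by move=> [[a b] [/= Aa Bb] <-]; exists a => //; exists b.
apply: continuous_compact.
  by apply: continuous_subspaceT => x; exact: mulg_continuous.
by apply: compact_setX; exact: subclosed_compact cG _.
Qed.

(* The Schreier generators of (V `&` A) N are corrected by elements of N to lie
   in V. *)
Lemma open_section_generators A N V (s : seq G) :
  compact [set: G] -> hausdorff_space G -> closed A -> closed N ->
  normal_in N A -> [set` s] `<=` A ->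
  A `<=` topologically_generated ([set` s] `|` N) ->
  normal_in V [set: G] -> open V ->
  exists S : seq G,
    [/\ (size S <= size s * group_index A (mulset (V `&` A) N))%N,
        [set` S] `<=` V `&` A &
        V `&` A `<=` topologically_generated ([set` S] `|` (V `&` N))].
Proof.
move=> cG hG cA cN nNA sA gA nVG oV.
have [sN sgA NA NJ] := nNA; have [sV _ _ VJ] := nVG.
have [N1 NM NV] := sN; have [V1 VM VV] := sV; have [A1 AM AV] := sgA.
set B := mulset _ _.
have sVA : subgroup (V `&` A) by exact: subgroupI.
have sB : subgroup B by apply: (subgroup_mulset sVA nNA) => x [].
have VAB : V `&` A `<=` B by exact: mulset_subl.
have NB : N `<=` B by exact: mulset_subr.
pose T := smallest subgroup ([set` s] `|` N).
have TA : T `<=` A by apply: smallest_sub => // x [/sA|/NA].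
have NT : N `<=` T by move=> x Nx; apply: sub_gen_smallest; right.
have sT : subgroup T by exact: subgroup_smallest.
have nNT : normal_in N T by split=> // x y /TA; exact: NJ.
have finV : finite_set (lcosets_set V A).
  by apply: sub_finite_set (compact_finite_index cG sV oV); exact: sub_lcosets.
have finB : finite_set (lcosets_set B A) by exact: lcosets_sub_finite finV.
have finBT : finite_set (lcosets_set B T).
  by apply: sub_finite_set finB; exact: sub_lcosets.
have [Y [sizeY YB BY]] := schreier nNT sB NB finBT.
(* Each [y] in [B] is a product of an element of V ∩ A and one of [N]; the first factor [v y]
   replaces the Schreier generator [y]. *)
have /choice[v vP] : forall y, exists v, B y -> (V `&` A) v /\ N (v^-1 * y).
  move=> y; have [[a VAa [n Nn <-]]|nB] := pselect (B y); last by exists 1 => /nB.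
  by exists a; rewrite mulKg.
have SVA : [set` map v Y] `<=` V `&` A.
  by move=> _ /mapP[y /YB[_ /vP[]] + _ ->].
exists (map v Y); split => //.
  rewrite size_map (leq_trans sizeY)// leq_mul2l; apply/orP; right.
  exact: group_indexS.
set D := topologically_generated _; have [sD cD] : closed_subgroup D by exact: tgen_subgroup.
have DA : D `<=` A.
  by apply: tgen_sub => // x [/SVA[]//|[_ /NA]].
have cDN : closed_subgroup (mulset D N).
  by split; [exact: subgroup_mulset nNA DA|exact: closed_mulset].
have [D1 DM DV] := sD.
have TBDN : T `&` B `<=` mulset D N.
  move=> x /BY; apply: smallest_sub; first by case: cDN.
  move=> y [Yy|Ny]; last by exact: mulset_subr.
  have [_ /vP[VAv Nvy]] := YB _ Yy.
  exists (v y); last by exists ((v y)^-1 * y) => //; rewrite mulVKg.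
  by apply: sub_tgen; left => /=; exact: map_f.
(* Density of [T] in [A] gives a point [t] of [T] near [b], inside the open coset bV. Then b^-1 t
   lies in V ∩ A, so [t] stays in [B]; and the closed set [mulset D N] contains the limit [b]. *)
have BDN : B `<=` mulset D N.
  move=> b Bb; have Ab : A b by apply: mulset_sub Bb => // x [].
  have [_ /closure_id ->] := cDN.
  move=> U nU; have [|t [Tt [Ut Vt]]] := gA _ Ab (U `&` lcoset_set b V).
    by apply: filterI => //; exact: nbhs_lcoset.
  exists t; split=> //; apply: TBDN; split=> //.
  move/mem_lcosetP: Vt => Vbt.
  have [_ BM _] := sB; rewrite -(mulVKg b t); apply: BM => //.
  by apply: VAB; split=> //; apply: AM; [exact: AV|exact: TA].
(* Write x = dn. Since [D] lies in [V], the factor [n] lies in V ∩ N and is itself a generator of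
   [D]. *)
move=> x [Vx Ax]; have [d Dd [n Nn e]] := BDN _ (VAB _ (conj Vx Ax)).
rewrite -e; apply: DM => //; apply: sub_tgen; right; split=> //.
have -> : n = d^-1 * x by rewrite -e mulKg.
have Vd : V d.
  move: Dd; apply: tgen_sub; first by split => //; exact: open_subgroup_closed.
  by move=> y [/SVA[]|[]].
by apply: VM => //; exact: VV.
Qed.

End TopologicalGroups.

(** * Finite generation, open normal cores and growth of indices *)

Lemma finitely_generatedP (G : topologicalGroupType) (H : set G) :
  finitely_generated H <-> exists s : seq G, topologically_generated [set` s] = H.
Proof.
by split=> [[n [t tH]]|[s sH]]; [exists t|exists (size s), (in_tuple s)].
Qed.

Section ProfiniteGroups.
Context {G : topologicalGroupType}.
Implicit Types (x y : G) (A B H K N V U X Y S : set G).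

(** Lifts of generators of A/N suffice: a neighbourhood [U] of [z] projects onto a neighbourhood of
    zN, which therefore contains a word in the generators; its lift, corrected by an element of [N],
    lies in [U]. *)
Lemma finitely_generated_quotient N A (nNA : normal_in N A) :
  finitely_generated [set: quotient_group nNA] ->
  exists s : seq G, [set` s] `<=` A /\
    A `<=` topologically_generated ([set` s] `|` N).
Proof.
move=> /finitely_generatedP[t tE].
have [sN [A1 AM AV] NA NJ] := nNA; have [N1 NM NV] := sN.
have /choice[f fP] : forall C : quotient_group nNA,
  exists x, exists Ax : A x, C = quotient_proj nNA Ax by exact: quotient_projE.
have fA : [set` map f t] `<=` A by move=> _ /mapP[C _ ->]; case: (fP C).
exists (map f t); split=> // z Az U nU.
pose T := smallest subgroup ([set` map f t] `|` N).
have [T1 TM TV] : subgroup T by exact: subgroup_smallest.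
have TA : T `<=` A by apply: smallest_sub => // x [/fA|/NA].
pose TQ := [set C : quotient_group nNA | exists x (Ax : A x),
  T x /\ C = quotient_proj nNA Ax].
have tTQ : smallest subgroup [set` t] `<=` TQ.
  apply: smallest_sub; first split.
  - by exists 1, A1; split=> //; exact: val_inj.
  - move=> _ _ [x [Ax [Tx ->]]] [y [Ay [Ty ->]]].
    by exists (x * y), (AM _ _ Ax Ay); split; [exact: TM|exact: quotient_mulE].
  - move=> _ [x [Ax [Tx ->]]].
    by exists x^-1, (AV _ Ax); split; [exact: TV|exact: quotient_invE].
  - move=> C /= tC; have [AfC eC] := fP C; exists (f C), AfC; split=> //.
    by apply: sub_gen_smallest; left; exact: map_f.
have : topologically_generated [set` t] (quotient_proj nNA Az) by rewrite tE.
move=> /(_ _ (nbhs_quotient_proj nNA Az nU)) [_ [/tTQ[x [Ax [Tx ->]]]]].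
move=> [y [Ay [Uy /(congr1 val)/= /(lcoset_eqP _ _ sN) Nxy]]].
exists y; split=> //; rewrite -(mulVKg x y); apply: TM => //.
by apply: sub_gen_smallest; right.
Qed.

Lemma nbhs1_subgroup_open H : subgroup H -> nbhs (1 : G) H -> open H.
Proof.
move=> [_ HM _] nH; rewrite openE => x Hx.
have : nbhs x ((fun y => x^-1 * y) @^-1` H).
  by apply: mulgl_continuous; rewrite mulVg.
by apply: filterS => y /= /(HM _ _ Hx); rewrite mulVKg.
Qed.

(** The intersection of all conjugates of [V] is open because whether [y ^ x] lies in [V] depends
    only on xV, so finitely many conjugates suffice. *)
Lemma open_normal_core V : compact [set: G] -> subgroup V -> open V ->
  exists N, [/\ normal_in N [set: G], open N & N `<=` V].
Proof.
move=> cG sV oV; have [V1 VM VV] := sV; have finV := compact_finite_index cG sV oV.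
pose N := [set y | forall x, V (y ^ x)]; have sN : subgroup N.
  split=> [x|y z Ny Nz x|y Ny x]; rewrite ?conj1g// ?conjMg ?conjVg.
    by apply: VM; [exact: Ny|exact: Nz].
  by apply: VV; exact: Ny.
exists N; split; last by move=> y /(_ 1); rewrite conjg1.
  by split=> // x y _ Ny z; rewrite -conjgM; exact: Ny.
have [r rP] := lcosets_repr V [set: G].
apply: nbhs1_subgroup_open => //.
have : nbhs (1 : G)
    (\bigcap_(C in [set` fset_set (lcosets_set V [set: G])]) (conjg^~ (r C) @^-1` V)).
  apply: filter_bigI => C _; apply: conjg_continuous; rewrite conj1g.
  exact: open_nbhs_nbhs.
apply: filterS => y Vy x; have GVx : lcosets_set V [set: G] (lcoset_set x V) by exists x.
have [_ /(lcoset_eqP _ _ sV) Vrx] := rP _ GVx.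
have := Vy (lcoset_set x V); rewrite /= in_fset_set// inE => /(_ GVx) Vyr.
have := VM _ _ (VM _ _ (VV _ Vrx) Vyr) Vrx.
by rewrite !group_simp.
Qed.

Lemma infinite_lcosets1 K : infinite_set K -> infinite_set (lcosets_set [set (1 : G)] K).
Proof.
move=> infK fin; apply: infK; have [r rP] := lcosets_repr [set (1 : G)] K.
apply: (sub_finite_set _ (finite_image r fin)) => x Kx.
exists (lcoset_set x [set 1]); first by exists x.
have [_ /(lcoset_eqP _ _ subgroup1)/=] := rP (lcoset_set x [set 1]) (imageP _ Kx).
by move=> /(congr1 (fun y => r (lcoset_set x [set 1]) * y)); rewrite mulVKg mulg1.
Qed.

(** Take representatives of at least [m] cosets of [C]. Their quotients avoid the closed set [C],
    and still do after multiplication by elements close to 1, so the representatives stay distinct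
    modulo CV once [V] is small. *)
Lemma group_index_unbounded C X (m : nat) : compact [set: G] -> closed_subgroup C ->
  infinite_set (lcosets_set C X) ->
  exists2 U, nbhs (1 : G) U & forall V, normal_in V [set: G] -> open V ->
    V `<=` U -> (m <= group_index X (mulset C V))%N.
Proof.
move=> cG [sC cC] infX; have [r rP] := lcosets_repr C X.
have [F FX mF] := infinite_set_fset m infX.
pose f (cd : set G * set G) :=
  [set v | cd.1 <> cd.2 -> ~ C ((r cd.1)^-1 * r cd.2 * v)].
exists (\bigcap_(cd in [set` (F `*` F)%fset]) f cd).
  apply: filter_bigI => -[c d]; rewrite !inE/= => /andP[Fc Fd].
  have [cd|cd] := pselect (c = d); first by apply: filterE => v /=.
  have : nbhs (1 : G) ((fun v => (r c)^-1 * r d * v) @^-1` (~` C)).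
    apply: mulgl_continuous; apply: open_nbhs_nbhs; split; first by rewrite openC.
    rewrite mulg1 /= => /(lcoset_eqP _ _ sC).
    by have [_ ->] := rP c (FX _ Fc); have [_ ->] := rP d (FX _ Fd).
  by apply: filterS => v /= Cv _.
move=> V nV oV VU; have [sV _ _ _] := nV.
have [C1 CM CV] := sC; have [V1 VM VV] := sV.
have sCV : subgroup (mulset C V) by exact: subgroup_mulset nV _.
apply: (leq_trans mF); apply: (group_index_ge (g := r)) => //.
- have finV := compact_finite_index cG sV oV.
  apply: sub_finite_set (lcosets_sub_finite sCV sV subgroupT _ finV) => //.
    exact: sub_lcosets.
  by move=> x [Vx _]; exact: mulset_subr.
- exact: fset_uniq.
- by move=> c Fc; case: (rP c (FX _ Fc)).
move=> c d Fc Fd [a Ca [v Vv e]]; apply: contrapT => cd.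
have /(_ (c, d)) := VU _ (VV _ Vv); rewrite /= !inE /= Fc Fd => /(_ isT cd).
by rewrite -e mulgK.
Qed.

End ProfiniteGroups.

(** * Rank gradient and generators along a subnormal chain *)

Section RankGradient.
Variables (R : realType) (G : topologicalGroupType).
Implicit Types (H K N V : set G).

Lemma rank_gradient_le V (s : seq G) : subgroup V -> open V ->
  topologically_generated [set` s] = V ->
  (rank_gradient R G <=
     (((size s)%:R - 1) / (group_index [set: G] V)%:R)%:E)%E.
Proof.
move=> sV oV sE; apply: (@le_trans _ _
  ((min_generators R V - 1) * ((group_index [set: G] V)%:R^-1)%:E)%E).
  by apply: ereal_inf_lbound; exists V.
rewrite EFinM; apply: lee_wpmul2r; first by rewrite lee_fin invr_ge0.
rewrite EFinB leeB//; apply: ereal_inf_lbound.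
by exists (size s) => //; exists (in_tuple s).
Qed.

(** In a finite Hausdorff group the trivial subgroup is open and needs no generators, so it
    contributes the negative value -1/|G| to the infimum. *)
Lemma rank_gradient_gt0_infinite : compact [set: G] -> hausdorff_space G ->
  (0 < rank_gradient R G)%E -> infinite_set [set: G].
Proof.
move=> cG hG RG0 finG.
have s1 := @subgroup1 G; have cs1 : closed_subgroup [set (1 : G)].
  by split => //; exact/accessible_closed_set1/hausdorff_accessible.
have fin1 : finite_set (lcosets_set [set (1 : G)] [set: G]) by exact: finite_image.
have o1 : open [set (1 : G)] by exact: closed_finite_index_open cs1.2 fin1.
have gen1 : topologically_generated [set` [::]] = [set (1 : G)].
  apply/seteqP; split; first exact: tgen_sub.
  by move=> _ ->; case: (@tgen_subgroup G [set` [::]]) => -[].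
have := lt_le_trans RG0 (rank_gradient_le s1 o1 gen1).
rewrite lte_fin sub0r mulN1r oppr_gt0 invr_lt0.
by rewrite ltrn0.
Qed.

(** Induction on the length of the chain, where [D] adds up the numbers of generators of the
    factors. The last inequality is the bound on the size of [S] with the denominator |C s : V ∩ C
    s| cleared. *)
Lemma chain_generators (s : nat) (C : nat -> set G) :
  compact [set: G] -> hausdorff_space G -> C 0%N = [set: G] ->
  (forall i, (i <= s)%N -> closed_subgroup (C i)) ->
  (forall i, (i < s)%N -> normal_in (C i.+1) (C i) /\
    exists t : seq G, [set` t] `<=` C i /\
      C i `<=` topologically_generated ([set` t] `|` C i.+1)) ->
  exists D : nat, forall V, normal_in V [set: G] -> open V ->
    exists S : seq G, [/\ [set` S] `<=` V,
      V `<=` topologically_generated ([set` S] `|` (V `&` C s)) &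
      (size S * group_index (C s) V <= D * group_index [set: G] V)%N].
Proof.
move=> cG hG C0; elim: s => [_ _|s IHs cC nC].
  exists 0%N => V [sV _ _ _] oV; exists [::]; rewrite C0 setIT; split=> //.
  by move=> x Vx; apply: sub_tgen; right.
have [|i si|D IH] := IHs; first by move=> i si; apply: cC; exact: leqW.
  by apply: nC; exact: leqW.
have [nCs [t [tC Ct]]] := nC s (ltnSn s).
have [sCs _] := cC s.+1 (leqnn _); have [sC cCs] := cC s (leqnSn _).
exists (D + size t)%N => V nV oV; have [sV _ _ VJ] := nV.
have [S1 [S1V VS1 size1]] := IH V nV oV.
have finV := compact_finite_index cG sV oV.
have [S2 [size2 S2V VS2]] :=
  open_section_generators cG hG cCs (cC s.+1 (leqnn _)).2 nCs tC Ct nV oV.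
exists (S1 ++ S2); split.
- by move=> x; rewrite /= mem_cat => /orP[/S1V//|/S2V[]].
- move=> x /VS1; apply: tgen_sub; first exact: tgen_subgroup.
  move=> y [S1y|/VS2]; first by apply: sub_tgen; left; rewrite /= mem_cat S1y.
  apply: tgen_sub; first exact: tgen_subgroup.
  move=> z [S2z|?]; apply: sub_tgen; last by right.
  by left; rewrite /= mem_cat S2z orbT.
have [_ _ CC _] := nCs.
(* The bound for [S1] persists because [C s.+1] meets no more cosets of [V] than [C s] does; for
   [S2] the two indices multiply to at most |G : V|. *)
rewrite size_cat mulnDl mulnDl leq_add//.
  apply: leq_trans size1; rewrite leq_mul2l; apply/orP; right.
  by apply: group_indexS => //; apply: sub_finite_set finV; exact: sub_lcosets.
apply: (@leq_trans (size t * (group_index (C s) (mulset (V `&` C s) (C s.+1)) *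
  group_index (C s.+1) V))); first by rewrite mulnA leq_mul2r size2 orbT.
rewrite leq_mul2l; apply/orP; right.
have [C1 CM CV] := sC; have [_ _ CV'] := sCs; have [_ CM' _] := sCs.
apply: mul_group_index_le => //.
  by apply: (subgroup_mulset _ nCs) => [|x []//]; exact: subgroupI.
move=> x x' y y' Cx Cx' Cy Cy' Vxy.
(* With g = (xy)^-1 x'y' in [V], one has x^-1 x' = (y g y^-1)(y y'^-1). *)
exists (((x * y)^-1 * (x' * y')) ^ y^-1).
  split; first exact: VJ.
  have [Cy0 Cy0'] := (CC _ Cy, CC _ Cy').
  rewrite conjgE invgK; do !(apply: (CM) || apply: (CV) || assumption).
exists (y * y'^-1); first by apply: CM' => //; exact: CV'.
by rewrite !group_simp.
Qed.

Lemma open_of_infinite_chain (s : nat) (C : nat -> set G) H :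
  compact [set: G] -> hausdorff_space G ->
  (forall U, nbhs (1 : G) U -> exists V, [/\ subgroup V, open V & V `<=` U]) ->
  (0 < rank_gradient R G)%E -> C 0%N = [set: G] ->
  (forall i, (i <= s)%N -> closed_subgroup (C i)) ->
  (forall i, (i < s)%N -> normal_in (C i.+1) (C i) /\
    exists t : seq G, [set` t] `<=` C i /\
      C i `<=` topologically_generated ([set` t] `|` C i.+1)) ->
  infinite_set (C s) -> C s `<=` H -> closed_subgroup H -> finitely_generated H ->
  open H.
Proof.
move=> cG hG baseG RG0 C0 cC nC infC CH cH /finitely_generatedP[h hH].
have [sH clH] := cH; have [H1 HM HV] := sH.
apply: contrapT => noH.
have infH : infinite_set (lcosets_set H [set: G]).
  by move=> fin; apply: noH; exact: closed_finite_index_open.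
have [D DP] := chain_generators cG hG C0 cC nC.
(* A positive real bound replaces the rank gradient, which may be infinite. *)
have [e e0 eRG] : exists2 e : R, (0 < e)%R & (e%:E <= rank_gradient R G)%E.
  move: RG0; case: (rank_gradient R G) => [r|_|//]; last by exists 1%R => //; rewrite leey.
  by rewrite lte_fin => r0; exists r.
(* Chosen so that D + d < eM, where d is the size of [h]; both indices are made at least [M]. *)
pose M := (Num.bound ((D + size h)%:R / e)%R).+1.
have s1 := @subgroup1 G; have cs1 : closed_subgroup [set (1 : G)].
  by split => //; exact/accessible_closed_set1/hausdorff_accessible.
have [U1 nU1 U1P] := group_index_unbounded M cG cs1 (infinite_lcosets1 infC).
have [U2 nU2 U2P] := group_index_unbounded M cG cH infH.
have [W [sW oW WU]] := baseG _ (filterI nU1 nU2).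
have [V [nV oV VW]] := open_normal_core cG sW oW.
have [sV _ _ VJ] := nV.
have finV := compact_finite_index cG sV oV.
set I := group_index [set: G] V.
have I0 : (0 < I)%N by apply: group_index_gt0 => //; exists 1.
(* This is the growth of indices over the trivial subgroup, which has infinitely many cosets in the
   infinite [C s]. *)
have M1 : (M <= group_index (C s) V)%N.
  have <- : mulset [set 1] V = V.
    apply/seteqP; split; last by apply: mulset_subr.
    by move=> _ [_ -> [v Vv <-]]; rewrite mul1g.
  by apply: U1P => // x /VW/WU[].
have M2 : (M <= group_index [set: G] (mulset H V))%N by apply: U2P => // x /VW/WU[].
have [S1 [S1V VS1 size1]] := DP V nV oV.
have n1H : normal_in [set 1] H.
  by split => // [x -> //|x y _ /= ->]; rewrite conj1g.
have hsub : [set` h] `<=` H by rewrite -hH; exact: sub_tgen.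
have hgen : H `<=` topologically_generated ([set` h] `|` [set 1]).
  rewrite -{1}hH; apply: tgen_sub; first exact: tgen_subgroup.
  by move=> x hx; apply: sub_tgen; left.
(* With the trivial group as normal subgroup of [H], this is the Schreier bound for V ∩ H in [H]. *)
have [S2 [size2 S2V VS2]] := open_section_generators cG hG clH cs1.2 n1H hsub hgen nV oV.
have genV : topologically_generated [set` S1 ++ S2] = V.
  apply/seteqP; split.
    apply: tgen_sub; first by split => //; exact: open_subgroup_closed.
    by move=> x; rewrite /= mem_cat => /orP[/S1V//|/S2V[]].
  have ct : closed_subgroup (topologically_generated [set` S1 ++ S2]) by exact: tgen_subgroup.
  move=> x /VS1; apply: tgen_sub => // y [S1y|[Vy /CH Hy]].
    by apply: sub_tgen; rewrite /= mem_cat S1y.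
  have /VS2 : (V `&` H) y by [].
  apply: tgen_sub => // z [S2z|[_ ->]]; last by case: ct => -[].
  by apply: sub_tgen; rewrite /= mem_cat S2z orbT.
(* The Schreier bound is multiplied by |G : HV|, using |G : HV| |H : V ∩ H| <= |G : V|. *)
have size2' : (size S2 * group_index [set: G] (mulset H V) <= size h * I)%N.
  apply: (@leq_trans (size h * (group_index [set: G] (mulset H V) *
      group_index H (mulset (V `&` H) [set 1])))).
    by rewrite [X in (_ <= _ * X)%N]mulnC mulnA leq_mul2r size2 orbT.
  rewrite leq_mul2l; apply/orP; right; apply: mul_group_index_le => //.
  - exact: subgroup_mulset nV _.
  - by apply: (subgroup_mulset _ n1H) => [|x []//]; exact: subgroupI.
  - move=> x x' y y' _ _ Hy Hy' Vxy.
    exists (y * y'^-1); first by apply: HM => //; exact: HV.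
    exists (((x * y)^-1 * (x' * y')) ^ y'^-1); first exact: VJ.
    by rewrite !group_simp.
  - move=> y y' Hy Hy' Vy; apply: mulset_subl => //; split=> //.
    by apply: HM => //; exact: HV.
have bound : (size (S1 ++ S2) * M <= (D + size h) * I)%N.
  rewrite size_cat !mulnDl leq_add//.
    by apply: leq_trans size1; rewrite leq_mul2l M1 orbT.
  by apply: leq_trans size2'; rewrite leq_mul2l M2 orbT.
have /(le_trans eRG) := rank_gradient_le sV oV genV.
rewrite lee_fin; apply/negP; rewrite -ltNge -/I.
rewrite ltr_pdivrMr ?ltr0n//.
have M0 : (0 < M%:R :> R)%R by rewrite ltr0n.
have DM : ((D + size h)%:R < e * M%:R)%R.
  rewrite mulrC -ltr_pdivrMr//; apply: lt_le_trans (archi_boundP _) _.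
    by rewrite divr_ge0// ltW.
  by rewrite ler_nat.
have : ((size (S1 ++ S2))%:R * M%:R <= (D + size h)%:R * I%:R :> R)%R.
  by rewrite -!natrM ler_nat.
have I0' : (0 < I%:R :> R)%R by rewrite ltr0n.
move: (size (S1 ++ S2))%:R%R (D + size h)%:R%R M%:R%R I%:R%R DM M0 I0' => n d m i dm m0 i0 nm.
(* The chain (n - 1)m <= nm <= di < eim contradicts e <= (n - 1)/i. *)
rewrite -(ltr_pM2r m0) (@le_lt_trans _ _ (n * m)%R)//.
  by rewrite ler_pM2r// gerBl.
by apply: (le_lt_trans nm); rewrite mulrAC ltr_pM2r.
Qed.

End RankGradient.

(** * Finite generation of finite and of open subgroups *)

Section OpenSubgroups.
Context {G : topologicalGroupType}.
Implicit Types (x y : G) (H K N V : set G).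

Lemma finite_index_finite H : subgroup H -> finite_set H ->
  finite_set (lcosets_set H [set: G]) -> finite_set [set: G].
Proof.
move=> sH finH finGH; have [r rP] := lcosets_repr H [set: G].
have := finite_image2 (fun C h => r C * h) finGH finH.
apply: sub_finite_set => x _; have GHx : lcosets_set H [set: G] (lcoset_set x H) by exists x.
exists (lcoset_set x H) => //; exists ((r (lcoset_set x H))^-1 * x); last by rewrite mulVKg.
by have [_ /(lcoset_eqP _ _ sH)] := rP _ GHx.
Qed.

Lemma finite_finitely_generated H : closed_subgroup H -> finite_set H ->
  finitely_generated H.
Proof.
move=> cH /finite_seqP[s sH]; apply/finitely_generatedP; exists s.
apply/seteqP; split; first by apply: tgen_sub => //; rewrite sH.
by move=> x Hx; apply: sub_tgen; rewrite -sH.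
Qed.

(** Schreier's argument in [G] generates the open normal core [V] of [H]; representatives of the
    finitely many cosets of [V] in [H] supply the rest. *)
Lemma open_finitely_generated H : compact [set: G] -> hausdorff_space G ->
  finitely_generated [set: G] -> subgroup H -> open H -> finitely_generated H.
Proof.
move=> cG hG /finitely_generatedP[g gG] sH oH; have [_ HM HV] := sH.
have [V [nV oV VH]] := open_normal_core cG sH oH; have [sV _ _ _] := nV.
have n1G : normal_in [set 1] [set: G].
  by split => //; [exact: subgroup1|move=> x y _ /= ->; rewrite conj1g].
have c1 : closed [set (1 : G)] by exact/accessible_closed_set1/hausdorff_accessible.
have gen : [set: G] `<=` topologically_generated ([set` g] `|` [set 1]).
  rewrite -{1}gG; apply: tgen_sub; first exact: tgen_subgroup.
  by move=> x gx; apply: sub_tgen; left.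
have [S [_ SV VS]] := open_section_generators cG hG (@closedT _) c1 n1G
  (@subsetT _ _) gen nV oV.
have finV : finite_set (lcosets_set V H).
  by apply: sub_finite_set (compact_finite_index cG sV oV); exact: sub_lcosets.
have [r rP] := lcosets_repr V H.
have /finite_seqP[t tE] := finite_image r finV.
have cD := tgen_subgroup ([set` S ++ t]).
apply/finitely_generatedP; exists (S ++ t); apply/seteqP; split.
  apply: tgen_sub; first by split => //; exact: open_subgroup_closed.
  move=> x; rewrite /= mem_cat => /orP[/SV[/VH]//|tx].
  have : [set` t] x by [].
  by rewrite -tE => -[C /rP[Hr _] <-].
move=> x Hx; have HVx : lcosets_set V H (lcoset_set x V) by exists x.
have [_ /(lcoset_eqP _ _ sV) Vrx] := rP _ HVx; have [[D1 DM _] _] := cD.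
rewrite -(mulVKg (r (lcoset_set x V)) x); apply: DM.
  have : [set` t] (r (lcoset_set x V)) by rewrite -tE; exists (lcoset_set x V).
  by move=> tr; apply: sub_tgen; rewrite /= mem_cat [_ \in t]tr orbT.
have /VS : (V `&` setT) ((r (lcoset_set x V))^-1 * x) by [].
apply: tgen_sub => // z [Sz|[_ ->]//].
by apply: sub_tgen; rewrite /= mem_cat Sz.
Qed.

End OpenSubgroups.

(** * Quotients by open normal subgroups *)

Section DiscreteQuotient.
Context {G : topologicalGroupType} (N : set G) (nN : normal_in N [set: G]).
Local Notation Q := (quotient_group nN).

Let proj (x : G) : Q := quotient_proj nN (I : [set: G] x).

Let projE (C : Q) : exists x, C = proj x.
Proof.
by have [x [Gx ->]] := quotient_projE C; exists x; exact: val_inj.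
Qed.

Let projM x y : proj (x * y) = proj x * proj y.
Proof. exact/esym/quotient_mulE. Qed.

Let projV x : proj x^-1 = (proj x)^-1.
Proof. exact/esym/quotient_invE. Qed.

Let proj1 : proj 1 = 1. Proof. exact: val_inj. Qed.

Lemma open_quotient_discrete (U : set Q) : open N -> open U.
Proof.
have [sN _ _ _] := nN; move=> oN; apply/open_quotient_groupE/quotient_group_openP.
exists [set x | U (proj x)]; last by move=> x Gx; rewrite (Prop_irrelevance Gx I).
rewrite openE => x Ux; apply: filterS (nbhs_lcoset x sN oN) => y /mem_lcosetP Nxy.
by rewrite /= -[proj y](@quotient_proj_eq _ _ _ nN x y I I Nxy).
Qed.

Lemma finite_quotient : finite_set (lcosets_set N [set: G]) -> finite_set [set: Q].
Proof.
have [sN _ _ _] := nN; have [r rP] := lcosets_repr N [set: G].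
move=> /(finite_image (fun C => proj (r C))); apply: sub_finite_set => C _.
have [x ->] := projE C; have GNx : lcosets_set N [set: G] (lcoset_set x N) by exists x.
exists (lcoset_set x N) => //; apply: quotient_proj_eq.
by have [_ /(lcoset_eqP _ _ sN)] := rP _ GNx.
Qed.

(** The quotient is finite and discrete, so only indices matter: a normal subgroup pulls back to an
    open normal subgroup [W] of [G] of the same index, a power of [p]. *)
Lemma open_quotient_pro_p (p : nat) : open N -> pro_p p G -> pro_p p Q.
Proof.
move=> oN [cG _ _ indexG]; have [sN _ _ _] := nN.
have finQ := finite_quotient (compact_finite_index cG sN oN).
have oQ (U : set Q) : open U by exact: open_quotient_discrete.
split.
- exact: finite_compact.
- move=> C D CD; have [||E [/= <- <-]//] := CD [set C] [set D];
    exact: open_nbhs_nbhs.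
- move=> U /nbhs_singleton U1; exists [set 1]; split=> //; first exact: subgroup1.
  by move=> _ ->.
move=> V nV _; pose W := [set x | V (proj x)].
have [sV _ _ VJ] := nV; have [V1 VM VV] := sV.
have sW : subgroup W.
  by split=> [|x y|x]; rewrite /W /= ?proj1 ?projM ?projV//; [exact: VM|exact: VV].
have nW : normal_in W [set: G].
  split=> // x y _; rewrite /W /= conjgE !projM projV.
  exact: VJ.
have oW : open W.
  apply: nbhs1_subgroup_open => //; apply: filterS (nbhs_lcoset 1 sN oN) => x.
  move=> /mem_lcosetP N1x; rewrite /W /=.
  by rewrite -[proj x](@quotient_proj_eq _ _ _ nN 1 x I I N1x) [quotient_proj _ _]proj1.
have [k Wk] := indexG W nW oW; exists k; rewrite -Wk.
have finW := compact_finite_index cG sW oW.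
have finV : finite_set (lcosets_set V [set: Q]) by exact: finite_image.
(* Coset representatives for either subgroup are carried to elements inequivalent modulo the other,
   which gives both inequalities. *)
apply/eqP; rewrite eqn_leq; apply/andP; split.
- have [r rP] := lcosets_repr V [set: Q].
  have /choice[f fE] := projE.
  apply: (group_index_ge (g := f \o r)) => //; first exact: fset_uniq.
  move=> C D; rewrite !in_fset_set// !inE => VC VD; rewrite /W /=.
  rewrite projM projV -!fE => /(lcoset_eqP _ _ sV).
  by have [_ ->] := rP _ VC; have [_ ->] := rP _ VD.
- have [r rP] := lcosets_repr W [set: G].
  apply: (group_index_ge (g := proj \o r)) => //; first exact: fset_uniq.
  move=> C D; rewrite !in_fset_set// !inE => WC WD /=.
  rewrite -projV -projM => /(lcoset_eqP _ _ sW).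
  by have [_ ->] := rP _ WC; have [_ ->] := rP _ WD.
Qed.

Lemma open_quotient_finitely_generated : compact [set: G] -> open N ->
  finitely_generated [set: Q].
Proof.
move=> cG oN; have [sN _ _ _] := nN.
apply: finite_finitely_generated; first by split => //; exact: closedT.
exact/finite_quotient/compact_finite_index.
Qed.

End DiscreteQuotient.

(** * The equivalences and the finite-or-open dichotomy *)

Theorem theorem1p1 (R : realType) (p : nat) (G : topologicalGroupType)
    (p_prime : prime p) (G_pro_p : pro_p p G)
    (G_fg : finitely_generated [set: G])
    (RG_gt0 : (0 < rank_gradient R G)%E) :
  (forall H : set G, closed_subgroup H -> finitely_generated H ->
    [<-> exists K : set G, [/\ closed_subgroup K, infinite_set K, K `<=` H &
           subnormal_fg p K];
         exists N : set G, [/\ closed N, infinite_set N, N `<=` H &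
           normal_in N [set: G]];
         open H])
  /\
  (forall K : set G, closed_subgroup K -> subnormal_fg p K ->
    finitely_generated K <-> finite_set K \/ open K).

Proof.
have [cG hG baseG _] := G_pro_p.
have infG := rank_gradient_gt0_infinite cG hG RG_gt0.
have open_of_subnormal (K H : set G) : closed_subgroup H -> finitely_generated H ->
    infinite_set K -> K `<=` H -> subnormal_fg p K -> open H.
  move=> cH fH infK KH [s [C [C0 Cs cC qC]]].
  apply: (open_of_infinite_chain cG hG baseG RG_gt0 C0 cC) => //; rewrite ?Cs//.
  by move=> i /qC[nC [_ /finitely_generated_quotient]].
(* The normal core is infinite because it has finite index in [G], which is infinite by positivity
   of the rank gradient. *)
have core (H : set G) : subgroup H -> open H -> exists N, [/\ open N, infinite_set N,
    N `<=` H & normal_in N [set: G]].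
  move=> sH oH; have [N [nN oN NH]] := open_normal_core cG sH oH; exists N.
  have [sN _ _ _] := nN; split=> // finN; apply: infG.
  exact/(finite_index_finite sN finN)/compact_finite_index.
split=> [H cH fH|K cK snK]; last first.
  split=> [fK|[finK|oK]]; last 2 first.
  - exact: finite_finitely_generated.
  - by apply: open_finitely_generated => //; case: cK.
  have [finK|infK] := pselect (finite_set K); [by left|right].
  exact: open_of_subnormal snK.
have [sH clH] := cH; tfae.
(* The passage from (1) to (2) goes through openness of [H], whose normal core is the subgroup
   sought. *)
- move=> [K [cK infK KH snK]].
  have [|N [oN infN NH nN]] := core H sH; first exact: open_of_subnormal snK.
  have [sN _ _ _] := nN.
  by exists N; split=> //; exact: open_subgroup_closed.
- move=> [N [clN infN NH nN]]; have [sN _ _ _] := nN.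
  (* A normal subgroup is a chain of length one, and the generators of [G] generate it modulo
     [N]. *)
  pose C i : set G := if i is 0%N then setT else N.
  apply: (@open_of_infinite_chain R G 1%N C H) => //.
    by move=> [|i] _; split=> //; exact: closedT.
  move=> [|//] _; split=> //; have /finitely_generatedP[g gG] := G_fg.
  exists g; split=> //=; rewrite -{1}gG; apply: tgen_sub; first exact: tgen_subgroup.
  by move=> x gx; apply: sub_tgen; left.
(* The open normal core is again reached in one step, with a finite pro-p factor. *)
- move=> oH; have [N [oN infN NH nN]] := core H sH oH; have [sN _ _ _] := nN.
  have cN : closed_subgroup N by split=> //; exact: open_subgroup_closed.
  exists N; split=> //.
  exists 1%N, (fun i => if i is 0%N then setT else N); split=> //.
    by move=> [|i] _ //; split=> //; exact: closedT.
  move=> [|//] _; exists nN; split; first exact: open_quotient_pro_p.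
  exact: open_quotient_finitely_generated.
Qed.
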